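(* Let $X$ be a reflexive real Banach space and let $A,B:X\rightrightarrows X^*$ be two maximal monotone operators such that $\operatorname{int}(D(A))=\operatorname{int}(D(B))\neq\emptyset$. If there exists a dense subset $D$ of $D(A)$ such that $$Ax\cap Bx\neq\emptyset\quad\text{for all } x\in D,$$ then $A=B$.
   Context: $X^*$ is the continuous dual of $X$, $\langle\cdot,\cdot\rangle$ the duality pairing; interior and density refer to the norm topology. For a set-valued operator $A:X\rightrightarrows X^*$, $D(A)=\{x\in X: Ax\neq\emptyset\}$. $A$ is monotone if $\langle x^*-y^*,x-y\rangle\ge 0$ whenever $x^*\in Ax$, $y^*\in Ay$, and maximal monotone if in addition its graph is not properly contained in the graph of another monotone operator. ''$D$ is a dense subset of $D(A)$'' means $D\subset D(A)\subset\overline{D}$. *)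

(* Defs.v *)
From HB Require Import structures.
From mathcomp Require Import all_boot all_order all_algebra.
From mathcomp Require Import all_classical all_reals all_analysis.
Set Implicit Arguments.
Unset Strict Implicit.
Unset Printing Implicit Defensive.
Import Order.TTheory GRing.Theory Num.Theory.
Import numFieldNormedType.Exports.
Local Open Scope classical_set_scope.
Local Open Scope ring_scope.

Section continuous_dual.
Context (R : realType) (X : normedModType R).

Definition dual_pred : {pred X -> R^o} :=
  [pred f : X -> R^o | `[< linear f /\ continuous f >]].

Record dual := Dual { dual_fun :> X -> R^o ; dual_funP : dual_fun \in dual_pred }.

HB.instance Definition _ := [isSub for dual_fun].
HB.instance Definition _ := gen_eqMixin dual.
HB.instance Definition _ := gen_choiceMixin dual.

Lemma dual_linear (f : dual) : linear f.
Proof. by case: f => f fP; case/asboolP: (fP). Qed.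

Lemma dual_continuous (f : dual) : continuous f.
Proof. by case: f => f fP; case/asboolP: (fP). Qed.

HB.instance Definition _ (f : dual) :=
  GRing.isLinear.Build R X R^o *:%R f (dual_linear f).

Lemma dual_ext (f g : dual) : f =1 g -> f = g.
Proof. by move=> fg; apply/val_inj/funext. Qed.

Lemma dual_submod_closed : submod_closed dual_pred.
Proof.
split=> [|a f g /asboolP[lf cf] /asboolP[lg cg]]; apply/asboolP; split.
- by move=> a x y; rewrite /= scaler0 addr0.
- by move=> x; exact: cvg_cst.
- move=> b x y; rewrite [LHS]/(a *: f (b *: x + y) + g (b *: x + y)).
  rewrite [RHS]/(b *: (a *: f x + g x) + (a *: f y + g y)).
  by rewrite lf lg !scalerDr !scalerA (mulrC a b); exact: addrACA.
- move=> x; apply: (@cvgD _ R^o _ _ _ (a *: f) g); last exact: cg.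
  apply: (@cvgZl_tmp _ R^o _ _ _ a f); exact: cf.
Qed.

HB.instance Definition _ :=
  GRing.isSubmodClosed.Build R (X -> R^o) dual_pred dual_submod_closed.
HB.instance Definition _ := [SubChoice_isSubLmodule of dual by <:].

Definition dual_norm (f : dual) : R :=
  sup [set `|f x| | x in [set x : X | `|x| <= 1]].

Let S (f : dual) := [set `|f x| | x in [set x : X | `|x| <= 1]].

Let has_supS (f : dual) : has_sup (S f).
Proof.
split; first by exists `|f 0|; exists 0 => //=; rewrite normr0 ler01.
have /bounded_funP/(_ 1)[M fM] :=
  (linear_bounded_continuous f).2 (@dual_continuous f).
by exists M => _ [x /= x1 <-]; exact: fM.
Qed.

Let dual_norm_ub (f : dual) (x : X) : `|x| <= 1 -> `|f x| <= dual_norm f.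
Proof. by move=> x1; apply: ub_le_sup; [case: (has_supS f)|exists x]. Qed.

Let dual_norm_le (f : dual) (M : R) :
  (forall x : X, `|x| <= 1 -> `|f x| <= M) -> dual_norm f <= M.
Proof.
by move=> fM; apply: ge_sup; [case: (has_supS f)|move=> _ [x /= /fM ? <-]].
Qed.

Lemma dual_norm_ge (f : dual) (x : X) : `|f x| <= dual_norm f * `|x|.
Proof.
have [->|x0] := eqVneq x 0; first by rewrite linear0 !normr0 mulr0.
rewrite -ler_pdivrMr ?normr_gt0// mulrC.
have := @dual_norm_ub f (`|x|^-1 *: x).
rewrite linearZ/= !normrZ normfV normr_id mulVf ?normr_eq0//; exact.
Qed.

Let dual_normD (f g : dual) : dual_norm (f + g) <= dual_norm f + dual_norm g.
Proof.
apply: dual_norm_le => x x1; rewrite [(f + g) x]/(f x + g x).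
by rewrite (le_trans (ler_normD _ _))// lerD// dual_norm_ub.
Qed.

Let dual_normZ_le (a : R) (f : dual) : dual_norm (a *: f) <= `|a| * dual_norm f.
Proof.
apply: dual_norm_le => x x1; rewrite [(a *: f) x]/(a * f x) normrM.
by rewrite ler_wpM2l// dual_norm_ub.
Qed.

Let dual_normZ (a : R) (f : dual) : dual_norm (a *: f) = `|a| * dual_norm f.
Proof.
apply/eqP; rewrite eq_le dual_normZ_le/=.
have [->|a0] := eqVneq a 0.
  by rewrite normr0 mul0r (le_trans _ (@dual_norm_ub _ 0 _)) ?normr0.
rewrite -{1}(scalerK a0 f) -ler_pdivlMl ?normr_gt0// -normfV.
exact: dual_normZ_le.
Qed.

Let dual_norm0_eq0 (f : dual) : dual_norm f = 0 -> f = 0.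
Proof.
move=> f0; apply: dual_ext => x; rewrite [RHS]/(0 : R).
by apply/eqP; rewrite -normr_le0 (le_trans (dual_norm_ge f x))// f0 mul0r.
Qed.

HB.instance Definition _ := Lmodule_isNormed.Build R dual
  dual_normD dual_normZ dual_norm0_eq0.

End continuous_dual.
Arguments dual_pred {R} X _.

Section reflexivity.
Context (R : realType) (X : normedModType R).

Lemma bidual_eval_subproof (x : X) :
  (fun f : dual X => f x : R^o) \in dual_pred (dual X).
Proof.
apply/asboolP.
have lin : linear (fun f : dual X => f x : R^o) by [].
split=> //.
pose L : {linear dual X -> R^o} :=
  HB.pack (fun f : dual X => f x : R^o) (GRing.isLinear.Build _ _ _ _ _ lin).
apply/(@linear_bounded_continuous _ _ _ L)/bounded_funP => r.
exists (r * `|x|) => f fr.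
by rewrite (le_trans (dual_norm_ge f x))// ler_wpM2r.
Qed.

Definition bidual_eval (x : X) : dual (dual X) := Dual (bidual_eval_subproof x).

Definition reflexive_space := forall phi : dual (dual X), exists x : X, bidual_eval x = phi.

End reflexivity.

Section monotone_operators.
Context (R : realType) (X : normedModType R).
Implicit Types A B : X -> set (dual X).

Definition dom A : set X := [set x | A x !=set0].

Definition graph A : set (X * dual X) := [set p | A p.1 p.2].

Definition monotone_op A := forall (x y : X) (x' y' : dual X),
  A x x' -> A y y' -> 0 <= (x' - y') (x - y).

Definition maximal_monotone A := monotone_op A /\
  forall B, monotone_op B -> ~ (graph A `<` graph B).

End monotone_operators.

(* Main.v *)
Require Import Defs.
From HB Require Import structures.
From mathcomp Require Import all_boot all_order all_algebra.
From mathcomp Require Import all_classical all_reals all_analysis.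
From mathcomp Require Import ring lra.
Import Order.TTheory GRing.Theory Num.Theory.
Import numFieldNormedType.Exports.
Local Open Scope classical_set_scope.
Local Open Scope ring_scope.

(* Let [U] be the common interior of the domains.  If [u] is in [U] and [y] in
   [dom A], then the half-open segment from [u] to [y] (excluding [y]) lies in
   [U]: monotonicity and the local boundedness of [A] at [u] (Baire) bound
   [sum_i l_i <a_i', a_i - x>] from below by [- K |sum_i l_i (a_i - x)|] for all
   finite combinations over the graph of [A], so Hahn-Banach yields an [x']
   monotonically related to [A], which belongs to [A x] by maximality.

   Let now [y'] be in [A y], [z'] in [B z] and [u'] in [A u] with [u] in [U].
   By the first step, applied to [B] and then to [A], some convex combinations
   [x = a y + b z + c u] lie in [U], with [a] equal to [1/2] and [c] arbitrarily
   small.  If [x'] is in [A x] and in [B x], the three monotonicity inequalities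
   at [x], weighted by [a, b, c], add up to
   [0 <= a <y', y - x> + b <z', z - x> + c <u', u - x>], and letting [c] tend to
   [0] gives [0 <= <y' - z', y - z>].  So the graph of [A] is contained in that
   of [B], and maximality of [A] concludes. *)

(** * Separation by maximal convex cones *)

Definition convex_cone {R : realType} {V : lmodType R} (E : set V) :=
  (forall v w, E v -> E w -> E (v + w)) /\
  (forall c v, 0 < c -> E v -> E (c *: v)).

Section cone_separation.
Context {R : realType} {X : normedModType R}.

(** A pair [(w, s)] stands for the constraint [f w <= s] on a functional [f]; this is consistency of
    the constraints at [w = 0]. *)
Definition nonneg_over0 (E : set (X * R^o)%type) :=
  forall s, E (0, s) -> 0 <= s.

Lemma maximal_cone (E0 : set (X * R^o)%type) :
  E0 !=set0 -> convex_cone E0 -> nonneg_over0 E0 ->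
  exists E, [/\ E0 `<=` E, convex_cone E, nonneg_over0 E &
    forall F, E `<=` F -> convex_cone F -> nonneg_over0 F -> F `<=` E].
Proof.
move=> [e0 E0e0] coneE0 posE0.
(* The guard makes the empty set satisfy [P], as the union of the empty chain must. *)
pose P (E : set (X * R^o)%type) :=
  [/\ E !=set0 -> E0 `<=` E, convex_cone E & nonneg_over0 E].
have [F FP totF|E [[E0E coneE posE] maxE]] := @Zorn_bigcup _ P.
  split.
  - move=> [e [E FE Ee]] v E0v; exists E => //.
    by have [E0E _ _] := FP _ FE; apply: E0E => //; exists e.
  - split=> [v w [E1 FE1 E1v] [E2 FE2 E2w]|c v c0 [E FE Ev]].
      have [E12|E21] := totF _ _ FE1 FE2.
        exists E2 => //; have [_ [addE _] _] := FP _ FE2.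
        by apply: addE => //; exact: E12.
      exists E1 => //; have [_ [addE _] _] := FP _ FE1.
      by apply: addE => //; exact: E21.
    by exists E => //; have [_ [_ scaleE] _] := FP _ FE; exact: scaleE.
  - by move=> s [E FE Es]; have [_ _ +] := FP _ FE; exact.
have En0 : E !=set0.
  apply: contrapT => E_eq0; have PE0 : P E0 by split=> // _ v.
  apply: (maxE _ _ PE0); split.
    by move=> v Ev; exfalso; apply: E_eq0; exists v.
  by move=> /(_ _ E0e0) Ee0; apply: E_eq0; exists e0.
exists E; split=> //; first exact: E0E.
move=> F EF coneF posF; apply: contrapT => nFE; apply: (maxE F) => //.
by split=> // _; apply: subset_trans EF; exact: E0E.
Qed.

(** The functional is the lower boundary of a maximal cone containing [E0]; the points over [w] at
    height [K] times its norm make it finite and continuous. *)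
Lemma cone_separation (K : R) (E0 : set (X * R^o)%type) :
  convex_cone E0 -> (forall w, E0 (w, K * `|w|)) -> nonneg_over0 E0 ->
  exists f : dual X, forall w s, E0 (w, s) -> f w <= s.
Proof.
move=> coneE0 normE0 posE0.
have [|E [E0E [addE scaleE] posE maxE]] := maximal_cone E0 _ coneE0 posE0.
  by exists (0, K * `|0 : X|).
have E00 : E (0, 0).
  by apply: E0E; have := normE0 0; rewrite normr0 mulr0.
(* otherwise the cone generated by [E] and [(v, s)] would be admissible *)
have alternative v s : ~ E (v, s) -> exists2 s', s' < - s & E (- v, s').
  move=> nEvs; apply: contrapT => nex; apply: nEvs.
  pose F := [set p | exists2 e, E e & exists2 l, 0 <= l & p = e + l *: (v, s)].
  apply: (maxE F).
  - by move=> e Ee; exists e => //; exists 0 => //; rewrite scale0r addr0.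
  - split=> [_ _ [e Ee [l l0 ->]] [e' Ee' [l' l'0 ->]]|c _ c0 [e Ee [l l0 ->]]].
      exists (e + e'); first exact: addE.
      by exists (l + l'); rewrite ?addr_ge0// scalerDl addrACA.
    exists (c *: e); first exact: scaleE.
    by exists (c * l); rewrite ?mulr_ge0// ?ltW// scalerDr scalerA.
  - move=> q [[e c] Eec [l]]; rewrite le_eqVlt => /predU1P[<-|l0].
      by rewrite scale0r addr0 => [[e0 ->]]; apply: posE; rewrite e0.
    move=> [e0 ->]; rewrite leNgt; apply/negP => q0; apply: nex.
    (* Lying over 0 forces [e = - l *: v], so dividing by [l] gives the pair excluded by [nex]. *)
    exists (l^-1 * c).
      rewrite mulrC ltr_pdivrMr// mulNr mulrC.
      by rewrite -subr_lt0 opprK.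
    have -> : (- v, l^-1 * c) = l^-1 *: (e, c).
      congr pair; apply: (scalerI (lt0r_neq0 l0)).
      rewrite scalerA divff ?gt_eqF// scale1r scalerN.
      by apply/esym/eqP; rewrite -addr_eq0; apply/eqP.
    by apply: scaleE => //; rewrite invr_gt0.
  - by exists (0, 0) => //; exists 1 => //; rewrite scale1r add0r.
pose S v := [set s | E (v, s)].
pose f v := inf (S v).
have S_ge v s s' : S v s -> S (- v) s' -> - s' <= s.
  move=> Svs Sv's'; rewrite -subr_ge0 opprK; apply: posE.
  have -> : (0, s + s') = (v, s) + (- v, s') by congr pair; rewrite subrr.
  exact: addE.
have Snorm v : S v (K * `|v|) by exact/E0E/normE0.
have infS v : has_inf (S v).
  split; first by exists (K * `|v|).
  by exists (- (K * `|- v|)) => s Svs; exact: S_ge Svs (Snorm _).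
have f_le v s : S v s -> f v <= s.
  by move=> Svs; apply: ge_inf => //; case: (infS v).
have le_f v c : (forall s, S v s -> c <= s) -> c <= f v.
  by move=> Sc; apply: lb_le_inf => //; case: (infS v).
have fN v : f (- v) = - f v.
  apply/eqP; rewrite eq_le; apply/andP; split; last first.
    apply: (le_f _ _) => s' Sv's'; rewrite lerNl; apply: (le_f _ _) => s Svs.
    exact: S_ge Svs Sv's'.
  (* If [- f (- v) < f v], then [(v, - f (- v))] is outside [E], and [alternative] yields a point
     over [- v] below the infimum. *)
  rewrite lerNr leNgt; apply/negP => fv.
  have [s' s'f Es'] : exists2 s', s' < f (- v) & E (- v, s').
    have [|s' s'f Es'] := alternative v (- f (- v)).
      by move=> /f_le; rewrite leNgt fv.
    by exists s' => //; rewrite -[f (- v)]opprK.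
  by have := f_le _ _ Es'; rewrite leNgt s'f.
have f_subadd v w : f (v + w) <= f v + f w.
  rewrite -lerBlDr; apply: (le_f _ _) => s Svs; rewrite lerBlDr -lerBlDl.
  apply: (le_f _ _) => s' Sws'; rewrite lerBlDl; apply: (f_le _ _).
  exact: addE Svs Sws'.
have f_add v w : f (v + w) = f v + f w.
  apply/eqP; rewrite eq_le f_subadd/=.
  by have := f_subadd (v + w) (- w); rewrite addrK fN lerBrDr.
have f_pscale_le c v : 0 < c -> f (c *: v) <= c * f v.
  move=> c0; rewrite -ler_pdivrMl//; apply: (le_f _ _) => s Svs.
  by rewrite ler_pdivrMl//; apply: (f_le _ _); exact: scaleE _ _ c0 Svs.
have f_pscale c v : 0 < c -> f (c *: v) = c * f v.
  move=> c0; apply/eqP; rewrite eq_le f_pscale_le//=.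
  rewrite -ler_pdivlMl// -{1}(scalerK (lt0r_neq0 c0) v).
  by apply: f_pscale_le; rewrite invr_gt0.
have f0 : f 0 = 0 by have := f_add 0 0; rewrite addr0; lra.
have f_scale c v : f (c *: v) = c * f v.
  have [c0|c0|->] := ltgtP c 0; last by rewrite scale0r mul0r.
    by rewrite -[c]opprK scaleNr fN f_pscale ?oppr_gt0// !mulNr !opprK.
  exact: f_pscale.
have f_linear : linear (f : X -> R^o) by move=> c v w; rewrite f_add f_scale.
pose L : {linear X -> R^o} :=
  HB.pack (f : X -> R^o) (GRing.isLinear.Build _ _ _ _ _ f_linear).
have f_dual : (f : X -> R^o) \in dual_pred X.
  apply/asboolP; split=> //.
  apply/(@linear_bounded_continuous _ _ _ L)/bounded_funP => r.
  exists (`|K| * r) => v vr.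
  have fK w : f w <= `|K| * `|w|.
    by rewrite (le_trans (f_le _ _ (Snorm w)))// ler_wpM2r// ler_norm.
  rewrite (@le_trans _ _ (`|K| * `|v|))// ?ler_wpM2l//.
  by rewrite ler_norml fK andbT lerNl -fN -(normrN v) fK.
by exists (Dual f_dual) => w s Es; apply: (f_le _ _); exact: E0E.
Qed.

End cone_separation.

(** * Bounds on functionals *)

Section dual_arith.
Context {R : realType} {X : normedModType R}.
Implicit Types (f g : dual X) (v w : X).

Lemma dualD f v w : f (v + w) = (f v : R) + f w :> R.
Proof. exact: linearD. Qed.

Lemma dual0 f : f 0 = 0 :> R.
Proof. exact: linear0. Qed.

Lemma dualN f v : f (- v) = - (f v : R) :> R.
Proof. exact: linearN. Qed.

Lemma dualZ f c v : f (c *: v) = c * (f v : R) :> R.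
Proof. exact: linearZ. Qed.

Definition dualE := (dualD, dualN, dualZ).

Lemma dual_le_of_ball f (r N : R) : 0 < r ->
  (forall w, `|w| <= r -> f w <= N) -> forall w, f w <= N / r * `|w|.
Proof.
move=> r0 fN w; have [->|w0] := eqVneq w 0.
  by rewrite linear0 normr0 mulr0.
have nw0 : 0 < `|w| by rewrite normr_gt0.
rewrite mulrAC ler_pdivlMr// -ler_pdivrMr//.
have := fN ((r / `|w|) *: w).
rewrite dualZ normrZ (gtr0_norm (divr_gt0 r0 nw0)) divfK ?gt_eqF//.
by rewrite mulrAC (mulrC r); exact.
Qed.

Lemma dual_le_norm f w : f w <= dual_norm f * `|w|.
Proof. exact: le_trans (ler_norm _) (dual_norm_ge f w). Qed.

End dual_arith.

(** * Bipolars for the monotonicity form *)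

Section bipolar.
Context {R : realType} {X : normedModType R}.

Lemma dual_addE (f g : dual X) v : (f + g) v = (f v : R) + g v :> R.
Proof. by []. Qed.

Lemma dual_scaleE c (f : dual X) v : (c *: f) v = c * (f v : R) :> R.
Proof. by []. Qed.

(* [(sum_i l_i, sum_i l_i (a_i - x), sum_i l_i a_i', sum_i l_i <a_i', a_i - x>)]
   for points [(a_i, a_i')] of a graph and weights [l_i >= 0].  [mono_form] is
   the bilinear form whose nonnegativity on single points is monotonicity;
   taking the bipolar of the graph replaces finite sums. *)
Record combination := Combination
  { weight : R; moment : X; slope : dual X; height : R }.

Definition comb_add p q := Combination (weight p + weight q)
  (moment p + moment q) (slope p + slope q) (height p + height q).

Definition comb_scale c p := Combination (c * weight p)
  (c *: moment p) (c *: slope p) (c * height p).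

Definition mono_form p q : R :=
  weight p * height q + weight q * height p
  - (slope p (moment q) : R) - (slope q (moment p) : R).

Lemma mono_formC p q : mono_form p q = mono_form q p.
Proof. by rewrite /mono_form; ring. Qed.

Lemma mono_formDl p q s :
  mono_form (comb_add p q) s = mono_form p s + mono_form q s.
Proof. by rewrite /mono_form [weight _]/= dual_addE dualD /=; ring. Qed.

Lemma mono_formZl c p q : mono_form (comb_scale c p) q = c * mono_form p q.
Proof. by rewrite /mono_form [weight _]/= dual_scaleE dualZ /=; ring. Qed.

Lemma mono_form_unit_height p : mono_form p (Combination 0 0 0 1) = weight p.
Proof.
transitivity (weight p * 1 + 0 * height p - (slope p 0 : R) - 0) => //.
by rewrite dual0; ring.
Qed.

Lemma mono_form0 p : mono_form (Combination 0 0 0 0) p = 0.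
Proof.
transitivity (0 * height p + weight p * 0 - 0 - (slope p 0 : R)) => //.
by rewrite dual0; ring.
Qed.

Definition polar (S : set combination) : set combination :=
  [set p | forall q, S q -> 0 <= mono_form p q].

Lemma polar_add S p q : polar S p -> polar S q -> polar S (comb_add p q).
Proof. by move=> Sp Sq s Ss; rewrite mono_formDl addr_ge0 ?Sp ?Sq. Qed.

Lemma polar_scale S c p : 0 <= c -> polar S p -> polar S (comb_scale c p).
Proof. by move=> c0 Sp s Ss; rewrite mono_formZl mulr_ge0 ?Sp. Qed.

Lemma bipolar_sub S : S `<=` polar (polar S).
Proof. by move=> p Sp q Sq; rewrite mono_formC; exact: Sq. Qed.

(** If [S] lies in its polar, so does its bipolar; hence nonnegativity of the form passes from [S]
    to the bipolar. *)
Lemma bipolar_ge0 S p q : S `<=` polar S ->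
  polar (polar S) p -> polar (polar S) q -> 0 <= mono_form p q.
Proof. by move=> SS Sp Sq; apply: Sp => s Ss; apply: Sq; exact: SS. Qed.

End bipolar.

(** * Local boundedness by Baire category *)

Lemma closed_cover_interior (R : realType) (X : completeNormedModType R)
    (F : (set X)^nat) :
  (forall n, closed (F n)) -> interior (\bigcup_n F n) !=set0 ->
  exists n, interior (F n) !=set0.
Proof.
move=> Fclosed intF0; apply: contrapT => Fint0.
have [i|x [intFx Fx]] :=
  @Baire R X (fun n => ~` F n) _ _ intF0 (open_interior _).
  split; first by rewrite openC.
  move=> O [x Ox] Oopen; apply: contrapT => OF0; apply: Fint0.
  exists i, x; apply: (filterS _ (open_nbhs_nbhs (conj Oopen Ox))) => w Ow.
  by apply: contrapT => nFw; apply: OF0; exists w.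
by have [n _ /(Fx n I)] := interior_subset intFx.
Qed.

Lemma monotone_op_le (R : realType) (X : normedModType R)
    (A : X -> set (dual X)) x y x' y' :
  monotone_op A -> A x x' -> A y y' -> y' (x - y) <= x' (x - y).
Proof. by move=> monA Ax Ay; rewrite -subr_ge0; exact: monA Ax Ay. Qed.

(** Baire bounds [a' (w - a)] uniformly for [w] near some [w0]; averaging with the bound at the
    reflection of [w0] through [u] moves the estimate to [u]. *)
Lemma monotone_locally_bounded (R : realType) (X : completeNormedModType R)
    (A : X -> set (dual X)) (u : X) :
  monotone_op A -> interior (dom A) u ->
  exists2 r, 0 < r & exists K, forall a a', `|u - a| <= r -> A a a' ->
    forall w, a' w <= K * `|w|.
Proof.
move=> monA /nbhs_closedballP[rho]; rewrite closed_ballE// => rhoA.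
(* Keeping [a] within 1 of [u] bounds [w - a], so that the sets [F n] cover the ball. *)
pose G := [set p : X * dual X | `|u - p.1| <= 1 /\ A p.1 p.2].
pose F n := closed_ball_ Num.norm u rho%:num `&`
  \bigcap_(p in G) [set w | p.2 (w - p.1) <= n%:R].
have F_cover w : `|u - w| <= rho%:num -> exists n, F n w.
  move=> uw; have [w' Aw] := rhoA _ uw.
  exists (Num.bound (dual_norm w' * (rho%:num + 1))).
  split=> // -[a a'] [/= ua Aa].
  apply: le_trans (ltW (archi_boundP _)).
    apply: le_trans (monotone_op_le _ _ _ _ _ _ _ monA Aw Aa) _.
    apply: le_trans (dual_le_norm _ _) _.
    rewrite ler_wpM2l//; first exact: (normr_ge0 w').
    by rewrite -(subrKA u) (le_trans (ler_normD _ _))// lerD// distrC.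
  by rewrite mulr_ge0//; exact: (normr_ge0 w').
have F_closed n : closed (F n).
  apply: closedI; first by rewrite -closed_ballE//; exact: closed_ball_closed.
  apply: closed_bigI => -[a a'] _ /=.
  rewrite [X in closed X]
    (_ : _ = a' @^-1` [set s | s <= n%:R + a' a]); last first.
    by apply/seteqP; split=> w /=; rewrite !dualE lerBlDr.
  apply: preimage_closed; last exact: closed_le.
  by move=> w _; exact: dual_continuous.
have [|n [w0 /nbhs_closedballP[eta]]] := closed_cover_interior _ _ F F_closed.
  exists u; apply/nbhs_closedballP; exists rho; rewrite closed_ballE// => w uw.
  by have [n Fnw] := F_cover _ uw; exists n.
rewrite closed_ballE// => etaF.
have [uw0 _] : F n w0 by apply: etaF; rewrite /closed_ball_/= subrr normr0.
(* The midpoint of this reflection and [w0 + 2 *: v] is [u + v]. *)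
have [|m [_ Fm]] := F_cover (u - (w0 - u)).
  by rewrite subKr distrC.
pose N : R := (n%:R + m%:R) / 2.
have bound v a a' : `|v| <= eta%:num / 2 -> `|u - a| <= 1 -> A a a' ->
    a' (u + v - a) <= N.
  move=> v_eta ua Aa.
  have [_ /(_ (a, a'))] : F n (w0 + 2 *: v).
    apply: etaF; rewrite /closed_ball_/= opprD addNKr normrN normrZ.
    by rewrite ger0_norm// mulrC -ler_pdivlMr.
  move=> /(_ (conj ua Aa))/= le1; have /= le2 := Fm (a, a') (conj ua Aa).
  rewrite /N; move: le1 le2; rewrite !dualE; lra.
have eta0 : 0 < eta%:num by [].
(* The 1 comes from [G]; a quarter for [w] and a quarter for [a - u] fill the radius in [bound]. *)
exists (Num.min 1 (eta%:num / 4)); first by rewrite lt_min ltr01 divr_gt0.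
exists (N / (eta%:num / 4)) => a a' + Aa; rewrite le_min => /andP[ua1 ua].
apply: dual_le_of_ball; first by rewrite divr_gt0.
move=> w w_eta; have := bound (w + (a - u)) _ _ _ ua1 Aa.
rewrite (_ : u + (w + (a - u)) - a = w); last by rewrite addrCA subrKC addrK.
apply.
rewrite (le_trans (ler_normD _ _))// (distrC a).
rewrite (_ : _ / 2 = eta%:num / 4 + eta%:num / 4); last by lra.
exact: lerD.
Qed.

(** * Segments in the domain *)

Section domain.
Context {R : realType} {X : normedModType R} (A : X -> set (dual X)).

Lemma maximal_monotone_mem x (x' : dual X) : maximal_monotone A ->
  (forall a a', A a a' -> a' (x - a) <= x' (x - a)) -> A x x'.
Proof.
move=> [monA maxA] relx.
pose B z : set (dual X) := A z `|` [set z' | z = x /\ z' = x'].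
apply: contrapT => nAx; apply: (maxA B).
  move=> v w v' w' [Av|[-> ->]] [Aw|[-> ->]].
  - exact: monA.
  - rewrite -[_ - _ : dual X]opprB -[v - x]opprB.
    rewrite [X in _ <= X](_ : _ = (x' - v') (x - v)) ?subr_ge0 ?relx//.
    by rewrite linearN; exact: opprK.
  - by rewrite subr_ge0 relx.
  - by rewrite subrr; exact: lexx.
split=> [[v v'] Av|BA]; first by left.
by apply: nAx; apply: (BA (x, x')); right.
Qed.

Definition atom x a (a' : dual X) := Combination 1 (a - x) a' (a' (a - x)).

Definition atoms x := [set p | exists a a', A a a' /\ p = atom x a a'].

(** On two atoms the form equals [(a' - b') (a - b)], whatever [x] is. *)
Lemma atoms_polar x : monotone_op A -> atoms x `<=` polar (atoms x).
Proof.
move=> monA _ [a [a' [Aa ->]]] _ [b [b' [Ab ->]]].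
rewrite /mono_form/= !mul1r.
have := monotone_op_le _ _ _ _ _ _ _ monA Aa Ab; rewrite !dualE; lra.
Qed.

(** Atoms have weight 1, so the pure unit height lies in their polar, and pairing with it reads off
    the weight. *)
Lemma bipolar_atoms_weight x p : polar (polar (atoms x)) p -> 0 <= weight p.
Proof.
move=> Hp; rewrite -mono_form_unit_height; apply: Hp => _ [a [a' [_ ->]]].
by rewrite mono_formC mono_form_unit_height.
Qed.

(* Adding a suitable multiple of [(1 - t) y + t (u + e)] brings the barycenter
   of the combination back to [x], where monotonicity forces the height to be
   nonnegative. *)
Lemma bipolar_atoms_height x y (y' : dual X) u t r (C : R) p :
  monotone_op A -> A y y' ->
  0 < t < 1 -> x = (1 - t) *: y + t *: u -> 0 < r ->
  (forall e, `|e| <= r -> exists2 v', A (u + e) v' & v' (u + e - x) <= C) ->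
  polar (polar (atoms x)) p ->
  0 <= height p + ((1 - t) * y' (y - x) + t * C) / (t * r) * `|moment p|.
Proof.
move=> monA Ay /andP[t0 t1] xE r0 bndC Hp.
set K := (_ + _) / _.
have tr0 : 0 < t * r by rewrite mulr_gt0.
(* Taking [rho] strictly above the norm allows division by it even when the moment vanishes. *)
have key rho : `|moment p| < rho -> 0 <= height p + K * rho.
  move=> mrho; have rho0 : 0 < rho by apply: le_lt_trans mrho.
  have [|v' Av vC] := bndC (- (r / rho) *: moment p).
    rewrite scaleNr normrN normrZ gtr0_norm ?divr_gt0//.
    by rewrite mulrAC ler_pdivrMr// ler_pM2l// ltW.
  set v := u + _ in Av vC.
  pose q := comb_add p (comb_scale (rho / (t * r))
    (comb_add (comb_scale (1 - t) (atom x y y')) (comb_scale t (atom x v v')))).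
  have Hq : polar (polar (atoms x)) q.
    apply: polar_add => //; apply: polar_scale; first by rewrite divr_ge0// ltW.
    apply: polar_add; (apply: polar_scale; first by rewrite ?subr_ge0 ltW).
      by apply: bipolar_sub; exists y, y'.
    by apply: bipolar_sub; exists v, v'.
  have q_moment : moment q = 0.
    rewrite /= (_ : (1 - t) *: (y - x) + _ = - (t * r / rho) *: moment p).
      rewrite scalerA mulrN mulrA divfK ?gt_eqF// divff ?gt_eqF//.
      by rewrite scaleN1r subrr.
    rewrite !scalerBr addrACA -opprD -scalerDl subrK scale1r.
    rewrite /v scalerDr addrA -xE addrAC subrr add0r scalerA.
    by rewrite mulrN mulrA.
  have q_weight : 0 < weight q.
    rewrite /= !mulr1 subrK mulr1 ltr_wpDl ?divr_gt0//.
    exact: bipolar_atoms_weight Hp.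
  (* With zero moment, [mono_form q q] is twice weight times height, and the weight is positive. *)
  have := bipolar_ge0 _ _ _ (atoms_polar _ monA) Hq Hq.
  rewrite /mono_form q_moment dual0 !subr0 -mulr2n pmulrn_lge0//.
  rewrite pmulr_rge0// => /le_trans; apply.
  rewrite /= lerD2l /K mulrAC -mulrA [leRHS]mulrC.
  by rewrite ler_pM2l// ler_pM2r ?invr_gt0// lerD2l ler_pM2l.
apply/ler_addgt0Pr => e e0; have [K0|K0] := leP K 0.
  have := key (`|moment p| + 1); rewrite ltrDl ltr01 => /(_ isT); nra.
have := key (`|moment p| + e / K); rewrite ltrDl divr_gt0// => /(_ isT).
by rewrite mulrDr [K * (_ / _)]mulrC divfK ?gt_eqF// addrA.
Qed.

End domain.

Lemma segment_dom (R : realType) (X : completeNormedModType R)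
    (A : X -> set (dual X)) y u t : maximal_monotone A ->
  dom A y -> interior (dom A) u -> 0 < t < 1 -> dom A ((1 - t) *: y + t *: u).
Proof.
move=> maxA [y' Ay] intu t01; set x := _ + _; have monA := maxA.1.
have [r1 r10 [M Mbnd]] := monotone_locally_bounded _ _ _ _ monA intu.
have /nbhs_closedballP[r2] := intu; rewrite closed_ballE// => r2A.
pose r := Num.min r1 r2%:num.
have r0 : 0 < r by rewrite lt_min r10/=.
pose C := `|M| * (r + `|u - x|).
have bndC e : `|e| <= r -> exists2 v', A (u + e) v' & v' (u + e - x) <= C.
  rewrite le_min => /andP[er1 er2].
  have ue : u - (u + e) = - e by rewrite opprD addNKr.
  have [|v' Av] := r2A (u + e); first by rewrite /closed_ball_/= ue normrN.
  exists v' => //.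
  apply: le_trans (Mbnd _ _ _ Av _) _; first by rewrite ue normrN.
  apply: (@le_trans _ _ (`|M| * `|u + e - x|)).
    by rewrite ler_wpM2r// ler_norm.
  rewrite ler_wpM2l// addrAC addrC (le_trans (ler_normD _ _))// lerD2r.
  by rewrite le_min er1 er2.
have height_ge p := bipolar_atoms_height A x y y' u t r C p
  monA Ay t01 (erefl _) r0 bndC.
set K0 := _ / _ in height_ge.
pose K := `|K0|.
pose H := polar (polar (atoms A x)).
(* The norm penalty, with the zero combination, supplies the points required by [cone_separation];
   [height_ge] gives nonnegativity over 0. *)
pose E := [set z : X * R^o |
  exists2 p, H p & height p + K * `|z.1 - moment p| <= (z.2 : R)].
have [|w|s|x' x'le] := cone_separation K E.
- split=> [[v s] [w s'] [p Hp vs] [q Hq ws]|c [v s] c0 [p Hp vs]].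
    exists (comb_add p q); first exact: polar_add.
    apply: le_trans (lerD vs ws); rewrite /= addrACA lerD2l -mulrDr.
    by rewrite (ler_wpM2l (normr_ge0 _))// opprD addrACA ler_normD.
  exists (comb_scale c p); first by apply: polar_scale => //; exact: ltW.
  rewrite /= -scalerBr normrZ gtr0_norm// mulrCA -mulrDr.
  by rewrite [leRHS]/(c * s) ler_pM2l.
- exists (Combination 0 0 0 0); last by rewrite /= subr0 add0r.
  by move=> q _; rewrite mono_form0.
- move=> [p Hp] /=; rewrite sub0r normrN; apply: le_trans.
  apply: le_trans (height_ge _ Hp) _.
  by rewrite lerD2l ler_wpM2r// ler_norm.
exists x'; apply: (maximal_monotone_mem A x x' maxA) => a a' Aa.
have := x'le (a - x) (a' (a - x)).
rewrite -[x - a]opprB !dualN lerN2; apply.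
exists (atom x a a'); first by apply: bipolar_sub; exists a, a'.
by rewrite /= subrr normr0 mulr0 addr0.
Qed.

(** A point near the barycenter is the barycenter, with the same [t], of [y] and a slightly moved
    [u]. *)
Lemma segment_interior (R : realType) (X : completeNormedModType R)
    (A : X -> set (dual X)) y u t : maximal_monotone A ->
  dom A y -> interior (dom A) u -> 0 < t < 1 ->
  interior (dom A) ((1 - t) *: y + t *: u).
Proof.
move=> maxA Ay intu t01; have /andP[t0 t1] := t01.
have /nbhs_interior/nbhs_ballP[r /= r0 rA] := intu.
apply/nbhs_ballP; exists (t * r); first by rewrite /= mulr_gt0.
move=> x; rewrite -ball_normE/= => xr.
have -> : x = (1 - t) *: y + t *: (u - t^-1 *: ((1 - t) *: y + t *: u - x)).
  by rewrite scalerBr scalerA divff ?gt_eqF// scale1r addrA subKr.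
apply: segment_dom => //; apply: rA; rewrite -ball_normE/= subKr.
by rewrite normrZ gtr0_norm ?invr_gt0// ltr_pdivrMl.
Qed.

(** * Barycentric inequalities and conclusion *)

Lemma ge0_of_small (R : realFieldType) (c L : R) :
  (forall s, 0 < s < 1 -> 0 <= c + s * L) -> 0 <= c.
Proof.
move=> cL; rewrite leNgt; apply/negP => c0.
have L0 : 0 < `|L| - c by rewrite subr_gt0 (lt_le_trans c0).
have LL : L <= `|L| := ler_norm L.
(* This choice gives [s < 1] and [c + s * L < c / 2]. *)
pose s := - c / (2 * (`|L| - c)).
have sE : s * (`|L| - c) = - c / 2 by rewrite /s; field; rewrite gt_eqF.
have s0 : 0 < s by rewrite divr_gt0 ?oppr_gt0// mulr_gt0.
have s1 : s < 1.
  by rewrite ltr_pdivrMr ?mulr_gt0// mul1r; have := normr_ge0 L; lra.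
by have := cL s; rewrite s0 s1 => /(_ isT); nra.
Qed.

(* At a common value [x'] at the barycenter [x] the contributions of [x'] to the
   three monotonicity inequalities cancel; a point of [D] close to [x] serves
   as well, because [A] is bounded near [x]. *)
Lemma barycenter_ge0 (R : realType) (X : completeNormedModType R)
    (A B : X -> set (dual X)) (D : set X) (a b c : R) (x y z u : X)
    (y' z' u' : dual X) :
  monotone_op A -> monotone_op B ->
  dom A `<=` closure D -> (forall d, D d -> A d `&` B d !=set0) ->
  interior (dom A) x -> 0 <= a -> 0 <= b -> 0 <= c -> a + b + c = 1 ->
  x = a *: y + b *: z + c *: u -> A y y' -> B z z' -> A u u' ->
  0 <= a * y' (y - x) + b * z' (z - x) + c * u' (u - x).
Proof.
move=> monA monB AD DAB intx a0 b0 c0 abc xE Ay Bz Au.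
have [r r0 [K Kbnd]] := monotone_locally_bounded _ _ _ _ monA intx.
(* The errors from replacing [x] by [d] add up to at most [s * r * M]. *)
pose M := `|K| + a * dual_norm y' + b * dual_norm z' + c * dual_norm u'.
apply: (@ge0_of_small _ _ (r * M)) => s /andP[s0 s1].
have sr0 : 0 < s * r by rewrite mulr_gt0.
have /(_ _ (nbhsx_ballx x _ sr0))[d [Dd]] := AD _ (interior_subset intx).
rewrite -ball_normE/= => xd; have [d' [Ad Bd]] := DAB _ Dd.
have yd := monotone_op_le _ _ _ _ _ _ _ monA Ay Ad.
have zd := monotone_op_le _ _ _ _ _ _ _ monB Bz Bd.
have ud := monotone_op_le _ _ _ _ _ _ _ monA Au Ad.
have nearr : `|x - d| <= r by rewrite (le_trans (ltW xd))// ger_pMl// ltW.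
have dx : d' (d - x) <= `|K| * (s * r).
  apply: le_trans (Kbnd _ _ nearr Ad _) _; rewrite distrC.
  by rewrite (le_trans (ler_wpM2r _ (ler_norm K)))// ler_wpM2l// ltW.
have nbnd (f : dual X) : f (x - d) <= dual_norm f * (s * r).
  rewrite (le_trans (dual_le_norm _ _))// ler_wpM2l//; last exact: ltW.
  exact: (normr_ge0 f).
have d'x : d' x = a * d' y + b * d' z + c * d' u :> R by rewrite xE !dualE.
have := nbnd y'; have := nbnd z'; have := nbnd u'.
have := ler_wpM2l a0 yd; have := ler_wpM2l b0 zd; have := ler_wpM2l c0 ud.
move=> h1 h2 h3 /(ler_wpM2l c0) h4 /(ler_wpM2l b0) h5 /(ler_wpM2l a0) h6.
move: h1 h2 h3 h4 h5 h6 dx; rewrite /M !dualE d'x.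
have cE : c = 1 - a - b by lra.
rewrite cE; nra.
Qed.

Theorem corollary4p2 (R : realType) (X : completeNormedModType R)
    (A B : X -> set (dual X)) :
  reflexive_space X ->
  maximal_monotone A -> maximal_monotone B ->
  interior (dom A) = interior (dom B) -> interior (dom A) !=set0 ->
  (exists D : set X,
     [/\ D `<=` dom A, dom A `<=` closure D
       & forall x, D x -> A x `&` B x !=set0]) ->
  A = B.
Proof.
move=> _ maxA maxB intAB [u intu] [D [_ AD DAB]].
have monA := maxA.1; have monB := maxB.1.
have AB : graph A `<=` graph B.
  move=> [y y'] /= Ay; apply: maximal_monotone_mem => // z z' Bz.
  have [u' Au] := interior_subset intu.
  suff : 0 <= (y' (y - z) - z' (y - z) : R) / 4 by lra.
  (* [c1] and [c2] are the coefficients of [s] and [s * s] in the weighted sum at [x]; its constant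
     term has the factor 1/4 since [x] tends to the midpoint of [y] and [z]. *)
  pose c1 : R := ((y' z : R) - y' u + z' y - z' u) / 4
    + (u' u : R) / 2 - ((u' y : R) + u' z) / 4.
  pose c2 : R := ((z' u : R) - z' z + u' z - u' u) / 4.
  apply: (@ge0_of_small _ _ (c1 + `|c2|)) => s s01; have /andP[s0 s1] := s01.
  pose x := (1 - 1 / 2) *: y + (1 / 2) *: ((1 - s) *: z + s *: u).
  have intx : interior (dom A) x.
    apply: segment_interior => //; [by exists y'| |lra].
    by rewrite intAB; apply: segment_interior; rewrite -?intAB//; exists z'.
  have xE : x = (1 / 2) *: y + ((1 - s) / 2) *: z + (s / 2) *: u.
    rewrite /x scalerDr !scalerA addrA; congr (_ *: _ + _ *: _ + _ *: _); lra.
  have := barycenter_ge0 _ _ A B D _ _ _ x y z u y' z' u' monA monB AD DAB intx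
    _ _ _ _ xE Ay Bz Au.
  have s2 : s * s * c2 <= s * `|c2|.
    rewrite -mulrA ler_pM2l// (le_trans (ler_wpM2l (ltW s0) (ler_norm _)))//.
    by rewrite ler_piMl// ltW.
  have -> : 1 / 2 * y' (y - x) + (1 - s) / 2 * z' (z - x) + s / 2 * u' (u - x)
      = (y' (y - z) - z' (y - z) : R) / 4 + s * c1 + s * s * c2 :> R.
    by rewrite xE !dualE /c1 /c2; field.
  have [? ? ? ?] : [/\ 0 <= 1 / 2 :> R, 0 <= (1 - s) / 2, 0 <= s / 2
      & 1 / 2 + (1 - s) / 2 + s / 2 = 1] by split; lra.
  move=> /(_ _ _ _ _)/le_trans; apply => //.
  by rewrite (mulrDr s c1) addrA lerD2l.
apply/funext => x; apply/seteqP; split=> x'; first exact: (AB (x, x')).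
move=> Bx; apply: contrapT => nAx; apply: (maxA.2 B monB); split=> // BA.
exact: nAx (BA (x, x') Bx).
Qed.
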